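(* Let $n,p\ge 1$, $\lambda\ge 0$, and let $\Sigma$ be an $n$-dimensional complete (without boundary) $\lambda$-submanifold properly immersed in the Gauss space $\mathbb G^{n+p}$. Put $r_1=\frac{-\lambda+\sqrt{\lambda^2+4n}}{2}$. If $\Sigma\subset\overline{B^{n+p}(r_1)}$, then $\Sigma$ is compact, $\Sigma\subset S^{n+p-1}(r_1)$, and $\Sigma$ is a minimal submanifold of $S^{n+p-1}(r_1)$. Moreover, if $p=1$, then $\Sigma=S^n(r_1)$.
   Context: The Gauss space $\mathbb G^m$ is $\mathbb R^m$ with its Euclidean metric and the density $e^{-f}=(2\pi)^{-m/2}e^{-|X|^2/2}$, where $X$ is the position vector. For an $n$-dimensional submanifold $\Sigma$ of $\mathbb G^{n+p}$, $\mathbf H$ denotes the mean curvature vector (the trace of the second fundamental form, not divided by $n$), $X^\perp$ the component of $X$ normal to $\Sigma$, and $\mathbf H_f=\mathbf H+X^\perp$ the weighted mean curvature vector. $\Sigma$ is a $\lambda$-submanifold if $|\mathbf H_f|=\lambda$ on $\Sigma$ for a constant $\lambda\ge 0$. $\overline{B^{m}(r)}=\{x\in\mathbb R^{m}:|x|\le r\}$ is the closed ball of radius $r$ centered at the origin, and $S^{m-1}(r)=\{x\in\mathbb R^m:|x|=r\}$ is the sphere of radius $r$ centered at the origin. *)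

(* Defs.v *)
From HB Require Import structures.
From mathcomp Require Import all_boot all_order all_algebra.
From mathcomp Require Import all_classical all_reals all_analysis.

Set Implicit Arguments.
Unset Strict Implicit.
Unset Printing Implicit Defensive.

Import Order.TTheory GRing.Theory Num.Theory.
Import numFieldNormedType.Exports.

Local Open Scope classical_set_scope.
Local Open Scope ring_scope.

(** * Euclidean structure of ['rV[R]_m]
    The library norm on matrices is the sup norm (which induces the usual
    topology), so the Euclidean one is defined separately. *)

Definition edot (R : realType) (m : nat) (v w : 'rV[R]_m) : R :=
  \sum_(i < m) v ord0 i * w ord0 i.

Definition enorm (R : realType) (m : nat) (v : 'rV[R]_m) : R :=
  Num.sqrt (edot v v).

Definition closed_eball (R : realType) (m : nat) (r : R) : set 'rV[R]_m :=
  [set v | enorm v <= r].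

Definition esphere (R : realType) (m : nat) (r : R) : set 'rV[R]_m :=
  [set v | enorm v = r].

(** * Smooth maps and smooth manifolds *)

(** Meant for an open set [U] and a finite-dimensional [V]. *)
Fixpoint Ck_on (R : realType) (V W : normedModType R) (k : nat)
    (f : V -> W) (U : set V) : Prop :=
  match k with
  | 0%N => forall x, U x -> {for x, continuous f}
  | k'.+1 => (forall x, U x -> differentiable f x) /\
             (forall v : V, Ck_on k' ('D_v f) U)
  end.

Definition smooth_on (R : realType) (V W : normedModType R)
    (f : V -> W) (U : set V) : Prop := forall k, Ck_on k f U.

(** [coord] is only relevant on [dom] and [param] on [coord @` dom]; outside
    these sets their values are arbitrary. *)
Record chart (R : realType) (n : nat) (T : topologicalType) := Chart {
  dom : set T;
  coord : T -> 'rV[R]_n;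
  param : 'rV[R]_n -> T;
  dom_open : open dom;
  img_open : open (coord @` dom);
  coordK : forall x, dom x -> param (coord x) = x;
  coord_continuous : forall x, dom x -> {for x, continuous coord};
  param_continuous : forall u, (coord @` dom) u -> {for u, continuous param}
}.

Definition img (R : realType) (n : nat) (T : topologicalType)
    (c : chart R n T) : set 'rV[R]_n := coord c @` dom c.

(** Manifolds have no boundary: charts take values in open subsets of
    ['rV[R]_n]. They need not be connected. *)
Record manifold (R : realType) (n : nat) := Manifold {
  carrier :> topologicalType;
  atlas : set (chart R n carrier);
  manifold_hausdorff : hausdorff_space carrier;
  manifold_second_countable : @second_countable carrier;
  atlas_cover : forall x : carrier, exists2 c, atlas c & dom c x;
  atlas_smooth : forall c c', atlas c -> atlas c' ->
    smooth_on (coord c' \o param c) (coord c @` (dom c `&` dom c'))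
}.

Section ImmersedSubmanifolds.
Variables (R : realType) (n m : nat) (M : manifold R n) (X : M -> 'rV[R]_m).

Definition local_rep (c : chart R n M) : 'rV[R]_n -> 'rV[R]_m := X \o param c.

(** The rows of the Jacobian ['J f u] are the partial derivatives of [f]. *)
Definition immersion : Prop :=
  forall c, atlas c ->
    smooth_on (local_rep c) (img c) /\
    (forall u, img c u -> row_free ('J (local_rep c) u)).

Definition proper_map : Prop :=
  forall K : set 'rV[R]_m, compact K -> compact (X @^-1` K).

Definition smooth_arc (g : R -> M) : Prop :=
  continuous g /\
  forall c, atlas c ->
    smooth_on (coord c \o g : R^o -> 'rV[R]_n) (g @^-1` dom c).

(** Length on [0, 1] for the metric induced by [X]. *)
Definition arc_length (g : R -> M) : \bar R :=
  (\int[lebesgue_measure]_(t in `[0%R, 1%R])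
     (enorm ('D_1 (X \o g : R^o -> 'rV[R]_m) t))%:E)%E.

(** Piecewise smooth curves are finite chains of smooth arcs over [0, 1]. *)
Fixpoint chain (x : M) (s : seq (R -> M)) (y : M) : Prop :=
  match s with
  | [::] => x = y
  | g :: s' => [/\ smooth_arc g, g 0 = x & chain (g 1) s' y]
  end.

Definition intrinsic_dist (x y : M) : \bar R :=
  ereal_inf [set (\sum_(g <- s) arc_length g)%E | s in [set s | chain x s y]].

Definition complete_metric : Prop :=
  forall u : nat -> M,
    (forall e : R, 0 < e -> exists N : nat, forall i j : nat,
       (N <= i)%N -> (N <= j)%N -> (intrinsic_dist (u i) (u j) < e%:E)%E) ->
    exists l : M, forall e : R, 0 < e -> exists N : nat, forall i : nat,
      (N <= i)%N -> (intrinsic_dist (u i) l < e%:E)%E.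

End ImmersedSubmanifolds.

(** * Extrinsic geometry of a parametrized submanifold [f] at [u] *)

Section Extrinsic.
Variables (R : realType) (n m : nat) (f : 'rV[R]_n -> 'rV[R]_m) (u : 'rV[R]_n).

Definition induced_metric : 'M[R]_n := 'J f u *m ('J f u)^T.

Definition tangent_proj (v : 'rV[R]_m) : 'rV[R]_m :=
  v *m ('J f u)^T *m invmx induced_metric *m 'J f u.

Definition normal_proj (v : 'rV[R]_m) : 'rV[R]_m := v - tangent_proj v.

Definition second_partial (i j : 'I_n) : 'rV[R]_m :=
  'D_(delta_mx ord0 i) ('D_(delta_mx ord0 j) f) u.

Definition metric_trace (B : 'I_n -> 'I_n -> 'rV[R]_m) : 'rV[R]_m :=
  \sum_(i < n) \sum_(j < n) invmx induced_metric i j *: B i j.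

Definition second_fundamental_form (i j : 'I_n) : 'rV[R]_m :=
  normal_proj (second_partial i j).

Definition mean_curvature : 'rV[R]_m := metric_trace second_fundamental_form.

(** [X^\perp] is the normal component of the position vector [f u]. *)
Definition weighted_mean_curvature : 'rV[R]_m :=
  mean_curvature + normal_proj (f u).

(** Orthogonal projection onto the tangent space at [f u] of the sphere
    centered at the origin through [f u]. *)
Definition sphere_proj (v : 'rV[R]_m) : 'rV[R]_m :=
  v - (edot v (f u) / edot (f u) (f u)) *: f u.

(** The Levi-Civita connection of the sphere is [sphere_proj] of the flat one,
    whence the second fundamental form inside the sphere. *)
Definition second_fundamental_form_sphere (i j : 'I_n) : 'rV[R]_m :=
  normal_proj (sphere_proj (second_partial i j)).

Definition mean_curvature_sphere : 'rV[R]_m :=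
  metric_trace second_fundamental_form_sphere.

End Extrinsic.

Definition lambda_submanifold (R : realType) (n m : nat) (M : manifold R n)
    (X : M -> 'rV[R]_m) (lambda : R) : Prop :=
  forall c, atlas c -> forall u, img c u ->
    enorm (weighted_mean_curvature (local_rep X c) u) = lambda.

Definition minimal_in_sphere (R : realType) (n m : nat) (M : manifold R n)
    (X : M -> 'rV[R]_m) (r : R) : Prop :=
  range X `<=` esphere r /\
  forall c, atlas c -> forall u, img c u ->
    mean_curvature_sphere (local_rep X c) u = 0.

(* Main.v *)
Require Import Defs.
From mathcomp Require Import all_boot all_order all_algebra.
From mathcomp Require Import all_classical all_reals all_analysis.
From mathcomp Require Import ring lra.

(** Since [Delta |X|^2 / 2 = n + <H, X> = n + <H_f, X^perp> - |X^perp|^2], and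
    [r1] is the positive root of [n - lambda r - r^2], the function [|X|^2] is
    subharmonic as long as [|X| <= r1].  [Sigma] is compact because [X] is
    proper; at a maximum of [|X|] one has [X = X^perp], so the maximum value is
    [r1].  By the strong maximum principle [|X| = r1] is an open condition, and
    the maximum argument on the open and closed set [|X| < r1] shows that this
    set is empty.  Equality in all the estimates then gives
    [H = - (n / r1^2) X], which is minimality in the sphere.  When [p = 1], a
    point [b] of the sphere is compared with the point of [Sigma] closest to
    it. *)

Set Implicit Arguments.
Unset Strict Implicit.
Unset Printing Implicit Defensive.

Import Order.TTheory GRing.Theory Num.Theory.
Import numFieldNormedType.Exports.
Local Open Scope classical_set_scope.
Local Open Scope ring_scope.

(** * The Euclidean inner product and norm on row vectors *)

Section Euclidean.
Context {R : realType}.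

Lemma edotE m (v w : 'rV[R]_m) : edot v w = (v *m w^T) ord0 ord0.
Proof. by rewrite mxE; apply: eq_bigr => i _; rewrite mxE. Qed.

Lemma edotC m (v w : 'rV[R]_m) : edot v w = edot w v.
Proof. by apply: eq_bigr => i _; rewrite mulrC. Qed.

Lemma edotDl m (u v w : 'rV[R]_m) : edot (u + v) w = edot u w + edot v w.
Proof. by rewrite !edotE mulmxDl mxE. Qed.

Lemma edotZl m a (v w : 'rV[R]_m) : edot (a *: v) w = a * edot v w.
Proof. by rewrite !edotE -scalemxAl mxE. Qed.

Lemma edotNl m (v w : 'rV[R]_m) : edot (- v) w = - edot v w.
Proof. by rewrite -scaleN1r edotZl mulN1r. Qed.

Lemma edotBl m (u v w : 'rV[R]_m) : edot (u - v) w = edot u w - edot v w.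
Proof. by rewrite edotDl edotNl. Qed.

Lemma edotDr m (u v w : 'rV[R]_m) : edot u (v + w) = edot u v + edot u w.
Proof. by rewrite edotC edotDl !(edotC u). Qed.

Lemma edotZr m a (v w : 'rV[R]_m) : edot v (a *: w) = a * edot v w.
Proof. by rewrite edotC edotZl (edotC v). Qed.

Lemma edotNr m (v w : 'rV[R]_m) : edot v (- w) = - edot v w.
Proof. by rewrite edotC edotNl (edotC v). Qed.

Lemma edotBr m (u v w : 'rV[R]_m) : edot u (v - w) = edot u v - edot u w.
Proof. by rewrite edotDr edotNr. Qed.

Lemma edot0l m (v : 'rV[R]_m) : edot 0 v = 0.
Proof. by rewrite edotE mul0mx mxE. Qed.

Lemma edot0r m (v : 'rV[R]_m) : edot v 0 = 0.
Proof. by rewrite edotC edot0l. Qed.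

Lemma edot_suml m (I : finType) (F : I -> 'rV[R]_m) (w : 'rV[R]_m) :
  edot (\sum_i F i) w = \sum_i edot (F i) w.
Proof.
by rewrite edotE mulmx_suml summxE; apply: eq_bigr => i _; rewrite edotE.
Qed.

Lemma edot_mulmx m k (v : 'rV[R]_m) (A : 'M[R]_(m, k)) (w : 'rV[R]_k) :
  edot (v *m A) w = edot v (w *m A^T).
Proof. by rewrite !edotE trmx_mul trmxK mulmxA. Qed.

Lemma edot_delta m i (v : 'rV[R]_m) : edot (delta_mx ord0 i) v = v ord0 i.
Proof. by rewrite edotE -rowE !mxE. Qed.

Lemma edot_ge0 m (v : 'rV[R]_m) : 0 <= edot v v.
Proof. by apply: sumr_ge0 => i _; rewrite -expr2 sqr_ge0. Qed.

Lemma edot_eq0 m (v : 'rV[R]_m) : (edot v v == 0) = (v == 0).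
Proof.
apply/eqP/eqP => [/eqP|->]; last exact: edot0l.
rewrite psumr_eq0 => [/allP v0|i _]; last by rewrite -expr2 sqr_ge0.
apply/rowP => i; rewrite mxE; apply/eqP.
by have := v0 i (mem_index_enum i); rewrite /= mulf_eq0 orbb.
Qed.

Lemma edot_gt0 m (v : 'rV[R]_m) : v != 0 -> 0 < edot v v.
Proof. by move=> v0; rewrite lt_def edot_ge0 edot_eq0 v0. Qed.

Lemma sqr_enorm m (v : 'rV[R]_m) : enorm v ^+ 2 = edot v v.
Proof. by rewrite sqr_sqrtr // edot_ge0. Qed.

Lemma enorm_ge0 m (v : 'rV[R]_m) : 0 <= enorm v.
Proof. exact: sqrtr_ge0. Qed.

Lemma cauchy_schwarz m (v w : 'rV[R]_m) :
  edot v w ^+ 2 <= edot v v * edot w w.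
Proof.
have [->|w0] := eqVneq w 0; first by rewrite !edot0r mulr0 expr0n.
(* This is the component of [v] orthogonal to [w], scaled by [edot w w] to avoid a division; the
   positive factor is cancelled at the end. *)
have := edot_ge0 (edot w w *: v - edot v w *: w).
rewrite !(edotBl, edotBr, edotZl, edotZr) (edotC w v).
rewrite (_ : _ - _ =
    edot w w * (edot v v * edot w w - edot v w ^+ 2)); last by ring.
by rewrite pmulr_rge0 ?edot_gt0 // subr_ge0.
Qed.

Lemma edot_le_enorm m (v w : 'rV[R]_m) : `|edot v w| <= enorm v * enorm w.
Proof.
rewrite -ler_sqr ?nnegrE ?mulr_ge0 ?enorm_ge0 // exprMn !sqr_enorm.
by rewrite real_normK ?num_real // cauchy_schwarz.
Qed.

Lemma enorm_le m (v : 'rV[R]_m) r :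
  0 <= r -> (enorm v <= r) = (edot v v <= r ^+ 2).
Proof. by move=> r0; rewrite -sqr_enorm ler_sqr // nnegrE ?enorm_ge0. Qed.

Lemma enorm_eq m (v : 'rV[R]_m) r :
  0 <= r -> enorm v = r <-> edot v v = r ^+ 2.
Proof.
move=> r0; rewrite -sqr_enorm; split => [->//|/eqP].
by rewrite eqrXn2 ?enorm_ge0 // => /eqP.
Qed.

Lemma coord_sqr_le_edot m (v : 'rV[R]_m) i : v ord0 i ^+ 2 <= edot v v.
Proof.
rewrite /edot (bigD1 i) //= expr2 lerDl sumr_ge0 // => j _.
by rewrite -expr2 sqr_ge0.
Qed.

Lemma coord_le_enorm m (v : 'rV[R]_m) i : `|v ord0 i| <= enorm v.
Proof.
rewrite -ler_sqr ?nnegrE ?enorm_ge0 // real_normK ?num_real // sqr_enorm.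
exact: coord_sqr_le_edot.
Qed.

Lemma norm_le_enorm m (v : 'rV[R]_m) : `|v| <= enorm v.
Proof.
rewrite [leLHS]/Num.Def.normr/= mx_normrE bigmax_le ?enorm_ge0 //.
by move=> [i j] _ /=; rewrite ord1 coord_le_enorm.
Qed.

End Euclidean.

(** * Continuity and derivatives of matrix-valued maps *)

Section EntrywiseContinuity.
Context {R : realType} {T : topologicalType}.
Implicit Types x : T.

(** Stated entry by entry, so that products, sums, determinants and inverses of matrices reduce to
    limits of real functions. *)
Definition mx_continuous_at m n (A : T -> 'M[R]_(m, n)) x :=
  forall i j, (fun y => A y i j) @ x --> A x i j.

Lemma mx_continuous_at_of m n (A : T -> 'M[R]_(m, n)) x :
  {for x, continuous A} -> mx_continuous_at A x.
Proof.
move=> cA i j; apply: (@continuous_comp _ _ _ A (fun M : 'M[R]_(m, n) => M i j)).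
  exact: cA.
exact: coord_continuous.
Qed.


Lemma continuous_sumr (I : finType) (F : I -> T -> R) x :
  (forall i, {for x, continuous (F i)}) ->
  {for x, continuous (fun y => \sum_i F i y)}.
Proof.
move=> cF; apply: (@cvg_big _ _ +%R) => [|i _]; first exact: add_continuous.
exact: cF.
Qed.

Lemma near_eq_mx_continuous_at m n (A B : T -> 'M[R]_(m, n)) x :
  (\forall y \near x, A y = B y) -> mx_continuous_at A x ->
  mx_continuous_at B x.
Proof.
move=> AB cA i j; rewrite -(nbhs_singleton AB).
apply: cvg_trans (cA i j); apply: near_eq_cvg.
by near=> y; rewrite (near AB y).
Unshelve. all: by end_near. Qed.

Lemma mx_continuous_at_mul m n p (A : T -> 'M[R]_(m, n)) (B : T -> 'M[R]_(n, p))
    x : mx_continuous_at A x -> mx_continuous_at B x ->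
  mx_continuous_at (fun y => A y *m B y) x.
Proof.
move=> cA cB i j; rewrite [X in _ --> X]mxE; under eq_fun do rewrite mxE.
apply: (@cvg_big _ _ +%R) => [|k _]; first exact: add_continuous.
exact: (continuousM (cA i k) (cB k j)).
Qed.

Lemma mx_continuous_at_row m n (A : T -> 'M[R]_(m, n)) k x :
  mx_continuous_at A x -> mx_continuous_at (fun y => row k (A y)) x.
Proof.
move=> cA i j; rewrite [X in _ --> X]mxE; under eq_fun do rewrite mxE.
exact: cA.
Qed.

Lemma mx_continuous_at_tr m n (A : T -> 'M[R]_(m, n)) x :
  mx_continuous_at A x -> mx_continuous_at (fun y => (A y)^T) x.
Proof. by move=> cA i j; rewrite [X in _ --> X]mxE; under eq_fun do rewrite mxE; exact: cA. Qed.

Lemma mx_continuous_at_sum m n (I : finType) (A : I -> T -> 'M[R]_(m, n)) x :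
  (forall k, mx_continuous_at (A k) x) ->
  mx_continuous_at (fun y => \sum_k A k y) x.
Proof.
move=> cA i j; rewrite [X in _ --> X]summxE; under eq_fun do rewrite summxE.
apply: (@cvg_big _ _ +%R) => [|k _]; first exact: add_continuous.
exact: cA.
Qed.

Lemma mx_continuous_at_scale m n (a : T -> R) (A : T -> 'M[R]_(m, n)) x :
  {for x, continuous a} -> mx_continuous_at A x ->
  mx_continuous_at (fun y => a y *: A y) x.
Proof.
move=> ca cA i j; rewrite [X in _ --> X]mxE; under eq_fun do rewrite mxE.
exact: (continuousM ca (cA i j)).
Qed.

Lemma continuous_det n (A : T -> 'M[R]_n) x :
  mx_continuous_at A x -> {for x, continuous (fun y => \det (A y))}.
Proof.
move=> cA; rewrite /determinant.
apply: (@cvg_big _ _ +%R) => [|s _]; first exact: add_continuous.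
apply: cvgM; first exact: cvg_cst.
apply: (@cvg_big R _ (@GRing.mul R)) => [|i _]; first exact: mul_continuous.
exact: cA.
Qed.

(** Cramer's rule: near [x] the inverse is the adjugate divided by the determinant, and both are
    polynomial in the entries. *)
Lemma mx_continuous_at_inv n (A : T -> 'M[R]_n) x :
  (\forall y \near x, A y \in unitmx) -> mx_continuous_at A x ->
  mx_continuous_at (fun y => invmx (A y)) x.
Proof.
move=> uA cA; have Ax := nbhs_singleton uA.
apply: (@near_eq_mx_continuous_at _ _
    (fun y => (\det (A y))^-1 *: \adj (A y))).
  by near=> y; rewrite /invmx (near uA y).
apply: mx_continuous_at_scale.
  apply: cvgV; last exact: continuous_det.
  by rewrite -unitfE -unitmxE.
move=> i j; rewrite [X in _ --> X]mxE; under eq_fun do rewrite mxE.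
apply: cvgM; first exact: cvg_cst.
apply: continuous_det => k l.
rewrite [X in _ --> X]mxE [X in _ --> X]mxE; under eq_fun do rewrite mxE mxE.
exact: cA.
Unshelve. all: by end_near. Qed.

Lemma continuous_edot m (v w : T -> 'rV[R]_m) x :
  mx_continuous_at v x -> mx_continuous_at w x ->
  {for x, continuous (fun y => edot (v y) (w y))}.
Proof.
move=> cv cw; apply: (@cvg_big _ _ +%R) => [|i _]; first exact: add_continuous.
exact: (continuousM (cv ord0 i) (cw ord0 i)).
Qed.

End EntrywiseContinuity.

(** * Directional derivatives and the second derivative test *)

Section Derivatives.
Context {R : realType}.

Lemma is_derive_edot (V : normedModType R) m (f g : V -> 'rV[R]_m) x v df dg :
  is_derive x v f df -> is_derive x v g dg ->
  is_derive x v (fun y => edot (f y) (g y)) (edot df (g x) + edot (f x) dg).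
Proof.
move=> [fxv <-] [gxv <-].
have dcoord (h : V -> 'rV[R]_m) (i : 'I_m) : derivable h x v ->
    is_derive x v (fun y => h y ord0 i : R) ('D_v h x ord0 i).
  move=> hxv; apply: DeriveDef; first by have /derivable_mxP := hxv; exact.
  by rewrite derive_mx // mxE.
have -> : (fun y => edot (f y) (g y)) =
    \sum_(i < m) ((fun y => f y ord0 i) * (fun y => g y ord0 i)).
  by apply/funext => y; rewrite fct_sumE.
rewrite /edot -big_split /=; apply: is_derive_sum => i.
have fi := dcoord f i fxv; have gi := dcoord g i gxv.
by apply: is_derive_eq; rewrite addrC; congr (_ + _); rewrite mulrC.
Qed.

(** The difference quotients of the two functions coincide. This brings one-variable calculus to
    directional derivatives. *)
Lemma is_derive_line (V W : normedModType R) (w : V -> W) (x v : V) (t : R) :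
  derivable w (x + t *: v) v ->
  is_derive t 1 (fun s : R => w (x + s *: v)) ('D_v w (x + t *: v)).
Proof.
move=> wv.
have e : (fun h : R => h^-1 *: (((fun s => w (x + s *: v)) \o shift t)
    (h *: 1) - w (x + t *: v))) =
  (fun h => h^-1 *: ((w \o shift (x + t *: v)) (h *: v) - w (x + t *: v))).
  apply/funext => h /=; congr (_ *: (w _ - _)).
  by rewrite [h *: 1]mulr1 scalerDl addrCA.
by apply: DeriveDef; rewrite /derivable /derive e.
Qed.

(** Restrict [w] to the line [h t = w (x + t *: v)]. If the second derivative were positive at 0,
    then [h'], which vanishes there, would be positive just to the right of 0, and the mean value
    theorem would give [h t > h 0]. *)
Lemma local_max_second_derivative (V : normedModType R) (w : V -> R) (x v : V) :
  (\forall y \near x, w y <= w x) -> (\forall y \near x, derivable w y v) ->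
  derivable ('D_v w) x v -> 'D_v w x = 0 /\ 'D_v ('D_v w) x <= 0.
Proof.
move=> wmax dw ddw.
pose h (t : R) := w (x + t *: v); pose h' (t : R) := 'D_v w (x + t *: v).
have cl : (fun t : R => x + t *: v) @ (0 : R) --> x.
  rewrite -[X in _ --> X]addr0 -(scale0r v).
  by apply: cvgD; [exact: cvg_cst|apply: cvgZ; [exact: cvg_id|exact: cvg_cst]].
have [e /= e0 he] : \forall t \near (0 : R), h t <= h 0 /\ is_derive t 1 h (h' t).
  near=> t; split.
    by rewrite /h scale0r addr0; near: t; exact: (cl _ wmax).
  by apply: is_derive_line; near: t; exact: (cl _ dw).
have {}he t : `|t| < e -> h t <= h 0 /\ is_derive t 1 h (h' t).
  by move=> te; apply: he; rewrite /= sub0r normrN.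
have in_e t : t \in `]- e, e[ -> `|t| < e by rewrite in_itv /= ltr_norml.
have h'0 : h' 0 = 0.
  have [_ d0] := he 0 (ltac:(by rewrite normr0)).
  have d1 : is_derive (0 : R) 1 h 0.
    apply: (@derive1_at_max _ h (- e) e).
    - by rewrite (le_trans (y := 0)) // ?oppr_le0 ltW.
    - by move=> t /in_e /he[_ []].
    - by rewrite in_itv /= oppr_lt0 e0.
    - by move=> t /in_e /he[].
  by rewrite -[h' 0](@derive_val _ _ _ _ _ _ _ d0) (@derive_val _ _ _ _ _ _ _ d1).
have xe : x + 0 *: v = x by rewrite scale0r addr0.
split; first by move: h'0; rewrite /h' xe.
rewrite leNgt; apply/negP => pos.
have dh' : is_derive (0 : R) 1 h' ('D_v ('D_v w) x).
  by rewrite -[in X in is_derive _ _ _ X]xe; apply: is_derive_line; rewrite xe.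
have dq : (fun t : R => t^-1 *: ((h' \o shift 0) (t *: 1) - h' 0)) @ 0^' -->
    'D_v ('D_v w) x.
  have [dh'0 <-] := dh'; exact: dh'0.
have [d /= d0 hd] := cvgr_gt _ dq _ pos.
(* Below [d] the quotients of [h'] are positive; below [e] the maximality of [h 0] and the
   differentiability of [h] are available. *)
pose t := Num.min d e / 2.
have me0 : 0 < Num.min d e by rewrite lt_min d0.
have t0 : 0 < t by rewrite divr_gt0.
have tm : t < Num.min d e by rewrite ltr_pdivrMr // ltr_pMr // ltr1n.
have td : t < d by rewrite (lt_le_trans tm) // ge_min lexx.
have te : t < e by rewrite (lt_le_trans tm) // ge_min lexx orbT.
have lte s : 0 <= s -> s <= t -> `|s| < e.
  by move=> s0 st; rewrite ger0_norm // (le_lt_trans st).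
have [] := @MVT _ h h' 0 t t0.
- by move=> s /[!in_itv]/= /andP[s0 st]; have [] := he s (lte s (ltW s0) (ltW st)).
- apply: continuous_in_subspaceT => s /[!inE]/= /[!in_itv]/= /andP[s0 st].
  have [_ [hs _]] := he s (lte s s0 st).
  exact/differentiable_continuous/derivable1_diffP.
move=> c /[!in_itv]/= /andP[c0 ct] hc.
have := hd c; rewrite /= sub0r normrN gtr0_norm // => /(_ (lt_trans ct td)).
move=> /(_ (lt0r_neq0 c0)); rewrite h'0 subr0 addr0 [c *: 1]mulr1.
rewrite pmulr_rgt0 ?invr_gt0 // => h'c.
have [+ _] := he t (lte t (ltW t0) (lexx _)).
by rewrite -subr_le0 hc leNgt subr0 mulr_gt0.
Unshelve. all: by end_near. Qed.

End Derivatives.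

(** * Chain rule for the exponential and expansion of second derivatives in coordinates *)

Section MoreDerivatives.
Context {R : realType}.

Lemma is_derive_line0 (V W : normedModType R) (w : V -> W) (x v : V) d :
  is_derive x v w d <-> is_derive (0 : R) 1 (fun s : R => w (x + s *: v)) d.
Proof.
have e : (fun h : R => h^-1 *: (((fun s => w (x + s *: v)) \o shift 0)
    (h *: 1) - w (x + 0 *: v))) =
  (fun h => h^-1 *: ((w \o shift x) (h *: v) - w x)).
  apply/funext => h /=; rewrite scale0r !addr0; congr (_ *: (w _ - _)).
  by rewrite [h *: 1]mulr1 addrC.
by split => -[d1 d2]; apply: DeriveDef; move: d1 d2;
   rewrite /derivable /derive e.
Qed.

Lemma is_derive_expR_comp (V : normedModType R) (w : V -> R) (x v : V) d :
  is_derive x v w d -> is_derive x v (fun y => expR (w y)) (expR (w x) * d).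
Proof.
move=> /is_derive_line0 dw; apply/is_derive_line0.
rewrite -[in expR _](addr0 x) -(scale0r v).
exact: is_derive1_comp.
Qed.

Lemma derive_row_sum (W : normedModType R) n (h : 'rV[R]_n -> W) u v :
  differentiable h u ->
  'D_v h u = \sum_i v ord0 i *: 'D_(delta_mx ord0 i) h u.
Proof.
move=> dh; rewrite deriveE // {1}[v]row_sum_delta linear_sum.
by apply: eq_bigr => i _; rewrite linearZ deriveE.
Qed.

(** Near [u] the map ['D_v f] is a combination of the coordinate derivatives with the constant
    coefficients [v ord0 j]; each of these derivatives is expanded in turn at [u]. *)
Lemma second_derivative_expand n m (f : 'rV[R]_n -> 'rV[R]_m) u v :
  (\forall y \near u, differentiable f y) ->
  (forall w, differentiable ('D_w f) u) ->
  is_derive u v ('D_v f)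
    (\sum_i \sum_j (v ord0 i * v ord0 j) *: second_partial f u i j).
Proof.
move=> df ddf.
have -> : \sum_i \sum_j (v ord0 i * v ord0 j) *: second_partial f u i j =
    \sum_j v ord0 j *: 'D_v ('D_(delta_mx ord0 j) f) u.
  rewrite exchange_big; apply: eq_bigr => j _ /=.
  rewrite [in RHS]derive_row_sum // scaler_sumr; apply: eq_bigr => i _.
  by rewrite scalerA mulrC.
apply: (@near_eq_is_derive _ _ _
  (\sum_(j < n) (v ord0 j *: 'D_(delta_mx ord0 j) f))).
  near=> y; rewrite fct_sumE derive_row_sum //; near: y; exact: df.
apply: is_derive_sum => j; apply: is_deriveZ.
exact/derivableP/diff_derivable.
Unshelve. all: by end_near. Qed.

End MoreDerivatives.

(** * Extrinsic geometry at a point *)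

Section ExtrinsicGeometry.
Context {R : realType} {n m : nat}.
Variables (f : 'rV[R]_n -> 'rV[R]_m) (u : 'rV[R]_n).
Hypothesis J_free : row_free ('J f u).

Local Notation J := ('J f u).
Local Notation gi := (invmx (induced_metric f u)).
Local Notation G := (metric_trace f u (second_partial f u)).

(** A vector [v] killed by [J *m J^T] satisfies [|v *m J|^2 = 0], hence is zero because the rows of
    [J] are free. *)
Lemma induced_metric_unit : induced_metric f u \in unitmx.
Proof.
rewrite -row_free_unit; apply: inj_row_free => v vJJ.
apply: (row_free_inj J_free); rewrite mul0mx; apply/eqP.
by rewrite -edot_eq0 edot_mulmx -mulmxA -/(induced_metric f u) vJJ edot0r.
Qed.

Lemma trmx_inv_metric : gi^T = gi.
Proof. by rewrite trmx_inv /induced_metric trmx_mul trmxK. Qed.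

Lemma edot_tangent_proj v w :
  edot (tangent_proj f u v) w = edot (v *m J^T *m gi) (w *m J^T).
Proof. by rewrite /tangent_proj edot_mulmx. Qed.

Lemma tangent_projK v : tangent_proj f u (tangent_proj f u v) = tangent_proj f u v.
Proof.
rewrite /tangent_proj -!(mulmxA _ J J^T) -/(induced_metric f u).
by rewrite mulmxKV // induced_metric_unit.
Qed.

Lemma edot_tangent_projC v w :
  edot (tangent_proj f u v) w = edot v (tangent_proj f u w).
Proof.
rewrite edot_tangent_proj [RHS]edotC edot_tangent_proj edot_mulmx.
by rewrite trmx_inv_metric edotC.
Qed.

(** The tangent projection is symmetric and idempotent, so the normal part of [v] is orthogonal to
    the tangent part of [w]. *)
Lemma edot_normal_proj v w :
  edot (normal_proj f u v) w = edot (normal_proj f u v) (normal_proj f u w).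
Proof.
rewrite /normal_proj !(edotBl, edotBr) -!edot_tangent_projC tangent_projK.
by rewrite subrr subr0.
Qed.

Lemma normal_projD v w :
  normal_proj f u (v + w) = normal_proj f u v + normal_proj f u w.
Proof. by rewrite /normal_proj /tangent_proj !mulmxDl opprD addrACA. Qed.

Lemma normal_projZ a v : normal_proj f u (a *: v) = a *: normal_proj f u v.
Proof. by rewrite /normal_proj /tangent_proj -!scalemxAl scalerBr. Qed.

Lemma normal_proj_sum (I : finType) (F : I -> 'rV[R]_m) :
  normal_proj f u (\sum_i F i) = \sum_i normal_proj f u (F i).
Proof. by rewrite /normal_proj /tangent_proj !mulmx_suml -sumrB. Qed.

Lemma normal_proj_id v : v *m J^T = 0 -> normal_proj f u v = v.
Proof. by move=> vJ; rewrite /normal_proj /tangent_proj vJ !mul0mx subr0. Qed.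

Lemma mean_curvatureE : mean_curvature f u = normal_proj f u G.
Proof.
rewrite /mean_curvature /metric_trace normal_proj_sum; apply: eq_bigr => i _.
by rewrite normal_proj_sum; apply: eq_bigr => j _; rewrite normal_projZ.
Qed.

Lemma enorm_normal_proj v : enorm (normal_proj f u v) <= enorm v.
Proof.
rewrite enorm_le ?enorm_ge0 // sqr_enorm -edot_normal_proj.
rewrite /normal_proj edotBl gerBl -tangent_projK edot_tangent_projC.
exact: edot_ge0.
Qed.

(* The normal part of [G] is the mean curvature vector [H], and
   <H, X> = <H_f, X^perp> - |X^perp|^2. *)
Lemma edot_metric_trace_ge lambda :
  enorm (weighted_mean_curvature f u) = lambda ->
  edot G (f u) >= edot (G *m J^T *m gi) (f u *m J^T)
    - lambda * enorm (f u) - enorm (f u) ^+ 2.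
Proof.
move=> hl; set N := normal_proj f u (f u).
have -> : edot G (f u) = edot (G *m J^T *m gi) (f u *m J^T)
    + (edot (weighted_mean_curvature f u) N - enorm N ^+ 2).
  rewrite /weighted_mean_curvature -/N edotDl sqr_enorm addrK mean_curvatureE.
  rewrite -edot_normal_proj -edot_tangent_proj -edotDl /normal_proj.
  by rewrite addrC subrK.
rewrite -addrA lerD2l -opprD -opprB lerN2 addrC.
(* It remains to bound [|N|] by [|f u|] in both terms, after Cauchy-Schwarz on the product with the
   weighted mean curvature. *)
have Nf : enorm N <= enorm (f u) by exact: enorm_normal_proj.
have l0 : 0 <= lambda by rewrite -hl enorm_ge0.
rewrite lerD //; last by rewrite ler_sqr ?nnegrE ?enorm_ge0.
have := edot_le_enorm (weighted_mean_curvature f u) N; rewrite hl => /ler_normlP[h _].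
by rewrite (le_trans h) // ler_wpM2l.
Qed.

(** Row [k] of [P] holds the chart coordinates of the tangential part of the [k]-th basis vector of
    the ambient space. These [m] directions replace an orthonormal tangent frame. *)
Local Notation P := (J^T *m gi).

(** [P^T *m P] is [gi *m J *m J^T *m gi], where the metric cancels one inverse. Hence metric traces
    are plain sums over the rows of [P]. *)
Lemma metric_inv_factor i j : gi i j = \sum_k P k i * P k j.
Proof.
have e : gi = P^T *m P.
  rewrite trmx_mul trmxK trmx_inv_metric mulmxA -(mulmxA gi).
  by rewrite -/(induced_metric f u) mulVmx ?induced_metric_unit // mul1mx.
by rewrite [in LHS]e mxE; apply: eq_bigr => k _; rewrite mxE.
Qed.

Lemma metric_trace_rows (B : 'I_n -> 'I_n -> 'rV[R]_m) :
  metric_trace f u B = \sum_k \sum_i \sum_j (row k P ord0 i * row k P ord0 j) *: B i j.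
Proof.
rewrite /metric_trace [RHS]exchange_big; apply: eq_bigr => i _ /=.
rewrite [RHS]exchange_big; apply: eq_bigr => j _ /=.
by rewrite metric_inv_factor scaler_suml; apply: eq_bigr => k _; rewrite !mxE.
Qed.

(** [P *m J] is the matrix of the orthogonal projection onto the tangent space, so the sum of its
    squared entries is its trace, the dimension [n]. *)
Lemma sum_edot_rows : \sum_k edot (row k P *m J) (row k P *m J) = n%:R.
Proof.
transitivity (\tr (P *m J *m (P *m J)^T)).
  by apply: eq_bigr => k _; rewrite -row_mul [RHS]mxE; apply: eq_bigr => l _; rewrite !mxE.
have -> : (P *m J)^T = P *m J by rewrite !trmx_mul trmxK trmx_inv_metric mulmxA.
rewrite -[P *m J *m _]mulmxA -(mulmxA _ gi) !mulmxA -(mulmxA _ J J^T).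
rewrite -/(induced_metric f u) mulmxKV ?induced_metric_unit //.
rewrite -mulmxA mxtrace_mulC -mulmxA -/(induced_metric f u).
by rewrite mulVmx ?induced_metric_unit // mxtrace1.
Qed.

End ExtrinsicGeometry.

(** * Strong maximum principle *)

Section Barrier.
Context {R : realType} {n m : nat}.
Variables (f : 'rV[R]_n -> 'rV[R]_m) (q : 'rV[R]_n) (eps alpha : R).

(** Hopf's comparison function centered at [q]: away from [q] the term in [alpha ^+ 2] of its second
    derivatives dominates for large [alpha]. *)
Definition gauss (y : 'rV[R]_n) : R := expR (- alpha * edot (y - q) (y - q)).

(** With [eps = alpha = 0] this is [|f|^2] itself, so the same computation also treats plain maxima
    of [|f|^2]. *)
Definition barrier (y : 'rV[R]_n) : R := edot (f y) (f y) + eps * gauss y.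

Definition barrier_deriv (v y : 'rV[R]_n) : R :=
  2 * edot ('D_v f y) (f y) - 2 * alpha * eps * (edot v (y - q) * gauss y).

Lemma scale_mulE (a b : R) : a *: b = a * b.
Proof. by []. Qed.

Lemma is_derive_subr_cst (y v : 'rV[R]_n) :
  is_derive y v (fun z => z - q) v.
Proof.
by apply: is_derive_eq; rewrite subr0.
Qed.

Lemma is_derive_gauss y v :
  is_derive y v gauss (- 2 * alpha * (edot v (y - q) * gauss y)).
Proof.
have d := is_derive_subr_cst y v.
apply: is_derive_eq.
  exact: (is_derive_expR_comp (is_deriveZ (- alpha) (is_derive_edot d d))).
rewrite -/(gauss y) (edotC _ v) scale_mulE; ring.
Qed.

Lemma is_derive_barrier y v :
  differentiable f y -> is_derive y v barrier (barrier_deriv v y).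
Proof.
move=> df; have d : is_derive y v f ('D_v f y) by exact/derivableP/diff_derivable.
apply: is_derive_eq.
  exact: (is_deriveD (is_derive_edot d d) (is_deriveZ eps (is_derive_gauss y v))).
by rewrite /barrier_deriv (edotC (f y)) scale_mulE; ring.
Qed.

Lemma is_derive_barrier_deriv y v d2f :
  differentiable f y -> is_derive y v ('D_v f) d2f ->
  is_derive y v (barrier_deriv v)
    (2 * (edot d2f (f y) + edot ('D_v f y) ('D_v f y)) + eps * gauss y *
      (4 * alpha ^+ 2 * edot v (y - q) ^+ 2 - 2 * alpha * edot v v)).
Proof.
move=> df ddf; have d : is_derive y v f ('D_v f y) by exact/derivableP/diff_derivable.
have dv : is_derive y v (fun z => edot v (z - q)) (edot v v).
  apply: is_derive_eq.
    exact: (is_derive_edot (is_derive_cst v y v) (is_derive_subr_cst y v)).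
  by rewrite edot0l add0r.
apply: is_derive_eq.
  apply: is_deriveB; first exact: (is_deriveZ 2 (is_derive_edot ddf d)).
  apply: (@is_deriveZ _ _ _ (fun z => edot v (z - q) * gauss z)).
  exact: (is_deriveM dv (is_derive_gauss y v)).
rewrite !scale_mulE; ring.
Qed.

(** The first conclusion is the vanishing of the gradient, read off in the coordinate directions.
    The second is half the sum of the second derivative tests along the rows of [P], which assembles
    the metric trace of the Hessian; the squared first derivatives of [f] contribute [n]. *)
Lemma barrier_local_max u : row_free ('J f u) ->
  (\forall y \near u, differentiable f y) ->
  (forall v, differentiable ('D_v f) u) ->
  (\forall y \near u, barrier y <= barrier u) ->
  let J := 'J f u in let gi := invmx (induced_metric f u) in
  let P := J^T *m gi in
  f u *m J^T = (alpha * eps * gauss u) *: (u - q) /\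
  edot (metric_trace f u (second_partial f u)) (f u) + n%:R + eps * gauss u *
    (2 * alpha ^+ 2 * (\sum_k edot (row k P) (u - q) ^+ 2) -
     alpha * \sum_k edot (row k P) (row k P)) <= 0.
Proof.
move=> J_free df ddf wmax J gi P.
have dfu := nbhs_singleton df.
pose d2f (v : 'rV[R]_n) := \sum_i \sum_j (v ord0 i * v ord0 j) *: second_partial f u i j.
have d2fP v : is_derive u v ('D_v f) (d2f v) by exact: second_derivative_expand.
have D1 v : \forall y \near u, is_derive y v barrier (barrier_deriv v y).
  by near=> y; apply: is_derive_barrier; near: y; exact: df.
(* The closed form holds on a whole neighborhood, so differentiating it gives the second derivative
   of the barrier. *)
have D1E v : \near u, barrier_deriv v u = 'D_v barrier u.
  by near=> y; rewrite (@derive_val _ _ _ _ _ _ _ (near (D1 v) y _)).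
have D2 v : is_derive u v ('D_v barrier) (2 * (edot (d2f v) (f u) +
    edot ('D_v f u) ('D_v f u)) + eps * gauss u *
    (4 * alpha ^+ 2 * edot v (u - q) ^+ 2 - 2 * alpha * edot v v)).
  apply: (near_eq_is_derive (D1E v)).
  exact: is_derive_barrier_deriv.
have key v : barrier_deriv v u = 0 /\ 2 * (edot (d2f v) (f u) +
    edot ('D_v f u) ('D_v f u)) + eps * gauss u *
    (4 * alpha ^+ 2 * edot v (u - q) ^+ 2 - 2 * alpha * edot v v) <= 0.
  have [//|||] := @local_max_second_derivative _ _ barrier u v.
  - by near=> y; have [] : is_derive y v barrier (barrier_deriv v y)
      by near: y; exact: D1.
  - by have [] := D2 v.
  by rewrite -(nbhs_singleton (D1E v)) (@derive_val _ _ _ _ _ _ _ (D2 v)).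
split.
  apply/rowP => i; have [+ _] := key (delta_mx ord0 i).
  rewrite /barrier_deriv deriveEjacobian // edot_mulmx !edot_delta => /eqP.
  by rewrite subr_eq0 => /eqP h; rewrite [RHS]mxE; lra.
have : \sum_k (2 * (edot (d2f (row k P)) (f u) +
    edot ('D_(row k P) f u) ('D_(row k P) f u)) + eps * gauss u *
    (4 * alpha ^+ 2 * edot (row k P) (u - q) ^+ 2 -
     2 * alpha * edot (row k P) (row k P))) <= 0.
  by apply: sumr_le0 => k _; exact: (key _).2.
rewrite big_split /= -!mulr_sumr big_split /= -edot_suml -metric_trace_rows //.
rewrite (_ : \sum_k edot ('D_(row k P) f u) _ = n%:R); last first.
  rewrite -(sum_edot_rows J_free); apply: eq_bigr => k _.
  by rewrite deriveEjacobian.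
rewrite sumrB -!mulr_sumr.
set A := \sum_k _ ^+ 2; set B := \sum_k _; set E := eps * _.
lra.
Unshelve. all: by end_near. Qed.

End Barrier.

(** * The maximum principle for [|f|^2] in one chart *)

Section StrongMaximum.
Context {R : realType} {n m : nat}.
Variables (f : 'rV[R]_n -> 'rV[R]_m) (U : set 'rV[R]_n) (lambda r : R).
Hypothesis U_open : open U.
Hypothesis f_smooth : smooth_on f U.
Hypothesis f_free : forall u, U u -> row_free ('J f u).
Hypothesis f_lambda :
  forall u, U u -> enorm (weighted_mean_curvature f u) = lambda.
Hypothesis lambda_ge0 : 0 <= lambda.
Hypothesis r_ge0 : 0 <= r.
Hypothesis r_root : lambda * r + r ^+ 2 = n%:R.

Lemma differentiable_rep u : U u -> differentiable f u.
Proof. by have [+ _] := f_smooth 1; exact. Qed.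

Lemma differentiable_derive_rep v u : U u -> differentiable ('D_v f) u.
Proof. by have [_ /(_ v)[+ _]] := f_smooth 2; exact. Qed.

Lemma continuous_derive2_rep v w u :
  U u -> {for u, continuous ('D_w ('D_v f))}.
Proof. by have [_ /(_ v)[_ /(_ w)]] := f_smooth 2; exact. Qed.

Lemma near_domain u : U u -> \forall y \near u, U y.
Proof. by move=> Uu; apply: open_nbhs_nbhs; split. Qed.

Lemma mx_continuous_at_jacobian u :
  U u -> mx_continuous_at (fun y => 'J f y) u.
Proof.
move=> Uu; apply: (@near_eq_mx_continuous_at _ _ _ _
    (fun y => \matrix_(i < n) 'D_(delta_mx ord0 i) f y)).
  near=> y; apply/row_matrixP => i.
  rewrite rowK deriveEjacobian -?rowE //; apply: differentiable_rep.
  by near: y; exact: near_domain.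
move=> i j; rewrite [X in _ --> X]mxE; under eq_fun do rewrite mxE.
exact: (mx_continuous_at_of (differentiable_continuous
  (differentiable_derive_rep (delta_mx ord0 i) Uu))).
Unshelve. all: by end_near. Qed.

Lemma mx_continuous_at_inv_metric u :
  U u -> mx_continuous_at (fun y => invmx (induced_metric f y)) u.
Proof.
move=> Uu; apply: mx_continuous_at_inv.
  near=> y; apply: induced_metric_unit; apply: f_free.
  by near: y; exact: near_domain.
have cJ := mx_continuous_at_jacobian Uu.
exact: (mx_continuous_at_mul cJ (mx_continuous_at_tr cJ)).
Unshelve. all: by end_near. Qed.

Lemma mx_continuous_at_metric_trace u : U u ->
  mx_continuous_at (fun y => metric_trace f y (second_partial f y)) u.
Proof.
move=> Uu; apply: mx_continuous_at_sum => i; apply: mx_continuous_at_sum => j.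
apply: mx_continuous_at_scale; first exact: mx_continuous_at_inv_metric.
exact/mx_continuous_at_of/continuous_derive2_rep.
Qed.

Lemma mx_continuous_at_subr (q u : 'rV[R]_n) :
  mx_continuous_at (fun y : 'rV[R]_n => y - q) u.
Proof.
apply: mx_continuous_at_of.
by apply: (@continuousB _ 'rV[R]_n _ id (fun=> q)); [exact: cvg_id|exact: cst_continuous].
Qed.

Lemma continuous_sqr_rep u :
  U u -> {for u, continuous (fun y => edot (f y) (f y))}.
Proof.
move=> Uu; have cf : mx_continuous_at f u.
  exact/mx_continuous_at_of/differentiable_continuous/differentiable_rep.
exact: continuous_edot.
Qed.

Lemma continuous_gauss (q : 'rV[R]_n) alpha u :
  {for u, continuous (gauss q alpha)}.
Proof.
have c := @mx_continuous_at_subr q u.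
apply: (@continuous_comp _ _ _ _ expR); last exact: continuous_expR.
apply: (@continuousM _ _ (fun=> - alpha) _ u); first exact: cst_continuous.
exact: (continuous_edot c c).
Qed.

Let P (u : 'rV[R]_n) := ('J f u)^T *m invmx (induced_metric f u).
Let G (u : 'rV[R]_n) := metric_trace f u (second_partial f u).

(* At a local maximum of [|f|^2 + eps * exp (- alpha |y - q|^2)] the
   subharmonicity of [|f|^2] bounds [alpha] by a continuous function of the
   point. *)
Definition threshold (q u : 'rV[R]_n) : R :=
  (\sum_k edot (row k (P u)) (row k (P u)) -
     edot (G u *m P u) (u - q)) /
  (2 * edot ((u - q) *m (P u)^T) ((u - q) *m (P u)^T)).

(** [(u - q) *m (P u)^T] is [u - q] multiplied by the inverse metric and then by the Jacobian, two
    injective maps. *)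
Lemma threshold_denom_gt0 q u : U u -> u != q ->
  0 < edot ((u - q) *m (P u)^T) ((u - q) *m (P u)^T).
Proof.
move=> Uu uq; apply: edot_gt0; apply: contra uq => /eqP.
rewrite /P trmx_mul trmxK (trmx_inv_metric f u) mulmxA => h.
have {}h : (u - q) *m invmx (induced_metric f u) = 0.
  by apply: (row_free_inj (f_free Uu)); rewrite h mul0mx.
rewrite -subr_eq0 -[u - q](mulmxKV (induced_metric_unit (f_free Uu))).
by rewrite h mul0mx.
Qed.

Lemma continuous_threshold q u :
  U u -> u != q -> {for u, continuous (threshold q)}.
Proof.
move=> Uu uq.
have cJ := mx_continuous_at_jacobian Uu.
have cP : mx_continuous_at P u.
  exact: (mx_continuous_at_mul (mx_continuous_at_tr cJ) (mx_continuous_at_inv_metric Uu)).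
have cq := @mx_continuous_at_subr q u.
have cb : {for u, continuous (fun y => \sum_k edot (row k (P y)) (row k (P y)))}.
  apply: continuous_sumr => k.
  have ck := @mx_continuous_at_row _ _ _ _ _ k _ cP.
  exact: (continuous_edot ck ck).
have cS : {for u, continuous (fun y : 'rV[R]_n => edot (G y *m P y) (y - q))}.
  have cG := mx_continuous_at_metric_trace Uu.
  exact: (continuous_edot (mx_continuous_at_mul cG cP) cq).
have ca : {for u, continuous
    (fun y : 'rV[R]_n => edot ((y - q) *m (P y)^T) ((y - q) *m (P y)^T))}.
  have c := mx_continuous_at_mul cq (mx_continuous_at_tr cP).
  exact: (continuous_edot c c).
have c2 : {for u, continuous (fun=> 2 : R)} by exact: cst_continuous.
apply: (@continuousM _ _ _ _ u (continuousB cb cS)).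
apply: (@continuousV _ _ _ u _ (continuousM c2 ca)).
by rewrite /= mulf_neq0 ?pnatr_eq0 // gt_eqF // threshold_denom_gt0.
Qed.

Lemma sum_sqr_edot_rows (A : 'M[R]_(m, n)) (y : 'rV[R]_n) :
  \sum_k edot (row k A) y ^+ 2 = edot (y *m A^T) (y *m A^T).
Proof.
rewrite /edot; apply: eq_bigr => k _; rewrite mxE -expr2; congr (_ ^+ 2).
by apply: eq_bigr => i _; rewrite !mxE mulrC.
Qed.

(** Subharmonicity of [|f|^2] up to a tangential term: in the ball,
    [lambda |f| + |f|^2 <= lambda r + r^2 = n]. *)
Lemma edot_metric_trace_ge_root u :
  U u -> edot (f u) (f u) <= r ^+ 2 ->
  edot (G u *m P u) (f u *m ('J f u)^T) - n%:R <= edot (G u) (f u).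
Proof.
move=> Uu fr; rewrite /P mulmxA.
apply: le_trans (edot_metric_trace_ge (f_free Uu) (f_lambda Uu)).
rewrite -addrA lerD2l -opprD lerN2 -r_root.
have fl : enorm (f u) <= r by rewrite enorm_le.
by rewrite lerD ?ler_wpM2l // ler_sqr // nnegrE enorm_ge0.
Qed.

(** The gradient condition makes the tangential term a multiple of [alpha * eps * gauss q alpha u].
    Dividing the second-order inequality by this positive factor leaves one that is linear in
    [alpha]. *)
Lemma threshold_ge q eps alpha u : U u -> 0 < eps -> 0 < alpha -> u != q ->
  edot (f u) (f u) <= r ^+ 2 ->
  (\forall y \near u, barrier f q eps alpha y <= barrier f q eps alpha u) ->
  alpha <= threshold q u.
Proof.
move=> Uu e0 a0 uq fr wmax.
have df : \forall y \near u, differentiable f y.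
  by near=> y; apply: differentiable_rep; near: y; exact: near_domain.
have ddf v : differentiable ('D_v f) u by exact: differentiable_derive_rep.
have [fJ] := barrier_local_max (f_free Uu) df ddf wmax.
rewrite sum_sqr_edot_rows => le0.
have := edot_metric_trace_ge_root Uu fr.
rewrite fJ -(mulrA alpha) edotZr => ge0.
have E0 : 0 < eps * gauss q alpha u by rewrite mulr_gt0 // expR_gt0.
rewrite /threshold ler_pdivlMr ?mulr_gt0 ?threshold_denom_gt0 //.
move: le0 ge0; rewrite -/(P u) -/(G u).
set S := edot (G u *m _) _; set a := edot (_ *m _) _; set b := \sum_k _.
set E := eps * _ in E0 * => le0 ge0.
have : alpha * E * (S + 2 * alpha * a - b) <= 0.
  by apply: le_trans le0; lra.
by rewrite pmulr_rle0; [lra|exact: mulr_gt0].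
Unshelve. all: by end_near. Qed.

(** At such a point the tangential term vanishes, so [s = |f u|] satisfies [n <= lambda s + s^2]; as
    [s <= r] and [r] solves the equation, [s = r]. *)
Lemma local_max_sphere u : U u -> edot (f u) (f u) <= r ^+ 2 ->
  (\forall y \near u, edot (f y) (f y) <= edot (f u) (f u)) ->
  edot (f u) (f u) = r ^+ 2.
Proof.
move=> Uu fr wmax.
have df : \forall y \near u, differentiable f y.
  by near=> y; apply: differentiable_rep; near: y; exact: near_domain.
have ddf v : differentiable ('D_v f) u by exact: differentiable_derive_rep.
have bmax : \forall y \near u, barrier f u 0 0 y <= barrier f u 0 0 u.
  by near=> y; rewrite /barrier !mul0r !addr0; near: y; exact: wmax.
have [fJ] := barrier_local_max (f_free Uu) df ddf bmax.
have := edot_metric_trace_ge (f_free Uu) (f_lambda Uu).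
rewrite fJ subrr scaler0 edot0r sub0r !mul0r addr0 => ge0 le0.
rewrite -sqr_enorm in fr *; have s0 := enorm_ge0 (f u).
have {}fr : enorm (f u) <= r by rewrite -ler_sqr.
have ls : lambda * enorm (f u) <= lambda * r by rewrite ler_wpM2l.
apply/eqP; rewrite eqrXn2 // eq_le fr /= -ler_sqr //.
by move: r_root ge0 le0 ls; lra.
Unshelve. all: by end_near. Qed.

Lemma mean_curvature_sphereE u :
  mean_curvature_sphere f u = normal_proj f u (sphere_proj f u (G u)).
Proof.
have sphere_projB I (F : I -> 'rV[R]_m) (s : seq I) :
    sphere_proj f u (\sum_(i <- s) F i) = \sum_(i <- s) sphere_proj f u (F i).
  elim/big_rec2: _ => [|i x y _ <-].
    by rewrite /sphere_proj edot0l mul0r scale0r subr0.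
  by rewrite /sphere_proj edotDl mulrDl scalerDl opprD addrACA.
have sphere_projZ a v : sphere_proj f u (a *: v) = a *: sphere_proj f u v.
  by rewrite /sphere_proj edotZl -mulrA -scalerA -scalerBr.
rewrite /G /mean_curvature_sphere /metric_trace sphere_projB normal_proj_sum.
apply: eq_bigr => i _; rewrite sphere_projB normal_proj_sum.
by apply: eq_bigr => j _; rewrite sphere_projZ normal_projZ.
Qed.

(* Constancy of [|f|^2] turns the inequalities of the maximum principle into
   <H, f> = - n, and then |H + (n / r^2) f|^2 = lambda^2 - (r - n / r)^2 = 0. *)
Lemma mean_curvature_sphere_eq0 u : 0 < r -> U u ->
  (\forall y \near u, edot (f y) (f y) = r ^+ 2) ->
  mean_curvature_sphere f u = 0.
Proof.
move=> r_gt0 Uu fr; have fu := nbhs_singleton fr.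
have df : \forall y \near u, differentiable f y.
  by near=> y; apply: differentiable_rep; near: y; exact: near_domain.
have ddf v : differentiable ('D_v f) u by exact: differentiable_derive_rep.
have bmax : \forall y \near u, barrier f u 0 0 y <= barrier f u 0 0 u.
  by near=> y; rewrite /barrier !mul0r !addr0 fu (near fr y).
have [fJ le0] := barrier_local_max (f_free Uu) df ddf bmax.
have := edot_metric_trace_ge_root Uu; rewrite fu lexx => /(_ isT).
move: fJ le0; rewrite subrr scaler0 !mul0r addr0 -/(G u) => fJ le0.
rewrite fJ edot0r sub0r => ge0.
have Gf : edot (G u) (f u) = - n%:R by lra.
have Nf : normal_proj f u (f u) = f u by exact: normal_proj_id.
have Hf : edot (mean_curvature f u) (f u) = - n%:R.
  rewrite mean_curvatureE /normal_proj edotBl (edot_tangent_proj f u) fJ.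
  by rewrite edot0r subr0.
have := congr1 (fun t => t ^+ 2) (f_lambda Uu).
rewrite sqr_enorm /weighted_mean_curvature Nf !(edotDl, edotDr).
rewrite (edotC (f u)) Hf fu => HH.
(* Since [f u] is normal and [<G, f> = - n], the mean curvature in the sphere becomes
   [H + (n / r^2) f]. *)
rewrite mean_curvature_sphereE /sphere_proj Gf fu -scaleNr.
rewrite normal_projD normal_projZ Nf -mean_curvatureE mulNr opprK.
set a := n%:R / r ^+ 2.
have ar2 : a * r ^+ 2 = n%:R by rewrite divfK // expf_neq0 // gt_eqF.
have ar : a * r = lambda + r.
  apply: (mulIf (lt0r_neq0 r_gt0)); rewrite -mulrA -expr2 ar2 -r_root; ring.
apply/eqP; rewrite -edot_eq0 !(edotDl, edotDr, edotZl, edotZr).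
rewrite (edotC (f u)) Hf fu; apply/eqP.
have : (a * r) ^+ 2 = (lambda + r) ^+ 2 by rewrite ar.
move: HH r_root ar2; set h := edot _ _.
move=> HH nr ar2 ar3.
have e1 : a * n%:R = (a * r) ^+ 2 by rewrite -ar2; ring.
have e2 : a * (a * r ^+ 2) = (a * r) ^+ 2 by ring.
rewrite !mulrN e1 e2 ar3; move: HH nr; rewrite !expr2; lra.
Unshelve. all: by end_near. Qed.

Hypothesis f_ball : forall u, U u -> edot (f u) (f u) <= r ^+ 2.

(** Hopf's argument. If [|f q| < r], the barrier centered at [q] attains its maximum over the closed
    [rho]-ball around [z] neither near [q] nor on the boundary. The maximum is thus interior and
    away from [q], where [threshold] bounds [alpha]; but [alpha] was chosen larger. *)
Lemma sphere_value_extends z q rho :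
  0 < rho -> (forall y, `|z - y| <= rho -> U y) ->
  edot (f z) (f z) = r ^+ 2 -> enorm (z - q) < rho / 2 ->
  edot (f q) (f q) = r ^+ 2.
Proof.
move=> rho0 BU fz zq.
have zq' : `|z - q| < rho / 2 by rewrite (le_lt_trans (norm_le_enorm _)).
have Uq : U q by apply: BU; rewrite ltW // (lt_trans zq') // ltr_pdivrMr // ltr_pMr // ltr1n.
apply/eqP; rewrite eq_le f_ball //= leNgt; apply/negP => fq.
(* Half the gap at [q]: near [q] one has [|f|^2 < r^2 - c], and adding [c] times a Gaussian at most
   1 keeps the barrier below [r^2]. *)
pose c := (r ^+ 2 - edot (f q) (f q)) / 2.
have c0 : 0 < c by rewrite divr_gt0 // subr_gt0.
have fqc : edot (f q) (f q) < r ^+ 2 - c by rewrite /c; lra.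
have : \forall y \near q, edot (f y) (f y) < r ^+ 2 - c.
  exact: (cvgr_lt _ (continuous_sqr_rep Uq)).
move=> /nbhs_ballP[eta /= eta0]; rewrite -ball_normE /= => fc.
pose B := [set y : 'rV[R]_n | `|z - y| <= rho].
have cB : compact B.
  apply: bounded_closed_compact; last exact: closed_closed_ball_.
  exists (`|z| + rho); split=> [|M M1 y /= zy]; first exact: num_real.
  rewrite (le_trans _ (ltW M1)) // -[y](subKr z) (le_trans (ler_normB _ _)) //.
  by rewrite lerD2l.
pose A := B `&` [set y : 'rV[R]_n | eta <= `|q - y|].
have cA : compact A.
  apply: compact_closedI => //.
  rewrite (_ : [set y | _] = ~` (ball q eta)).
    by apply: open_closedC; exact: ball_open.
  rewrite -ball_normE; apply/seteqP; split=> y /=; rewrite leNgt.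
    by move=> /negP.
  by move=> /negP.
have Aq y : A y -> U y /\ y != q.
  move=> [By ey]; split; first exact: BU.
  by apply/eqP => yq; move: ey; rewrite /= yq subrr normr0 leNgt eta0.
(* [A] is compact and avoids [q], so the continuous [threshold q] is bounded on it. *)
have [alpha alpha0 tha] : exists2 alpha : R, 0 < alpha & forall y, A y -> threshold q y < alpha.
  have tc : {within A, continuous (threshold q)}.
    apply: continuous_in_subspaceT => y /[!inE] /Aq[Uy yq].
    exact: continuous_threshold.
  have /ex_strict_bound_gt0[k k0 kA] := compact_bounded (continuous_compact tc cA).
  exists k => // y Ay; apply: le_lt_trans (ler_norm _) _.
  by apply: (kA (threshold q y)); exists y.
have [] := @EVT_max_rV _ _ (barrier f q c alpha) B.
- by exists z; rewrite /B /= subrr normr0 ltW.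
- exact: cB.
- apply: continuous_in_subspaceT => y /[!inE] By.
  have Uy := BU y By.
  apply: (@continuousD _ _ _ (fun y => edot (f y) (f y)) (fun y => c * gauss q alpha y)).
    exact: continuous_sqr_rep.
  apply: (@continuousM _ _ (fun=> c)); first exact: cst_continuous.
  exact: continuous_gauss.
move=> x /[!inE] Bx xmax.
have Ux := BU x Bx.
have Wz : r ^+ 2 + c * gauss q alpha z <= barrier f q c alpha x.
  by rewrite -fz; apply: xmax; rewrite inE /B /= subrr normr0 ltW.
have gz0 : 0 < c * gauss q alpha z by rewrite mulr_gt0 // expR_gt0.
have Ax : A x.
  split => //=; rewrite leNgt; apply/negP => qx.
  have g1 : gauss q alpha x <= 1.
    rewrite -expR0 ler_expR mulNr oppr_le0 mulr_ge0 ?edot_ge0 //; exact: ltW.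
  have cg : c * gauss q alpha x <= c by rewrite ger_pMr.
  by have := fc x qx; move: Wz; rewrite /barrier; lra.
(* A boundary point is at sup distance more than [rho / 2] from [q], hence farther from [q] than [z]
   is; its Gaussian is smaller, and [|f x| <= r = |f z|], so [z] would give a larger value. *)
have zx : `|z - x| < rho.
  rewrite lt_neqAle Bx andbT; apply/eqP => zx.
  have : c * gauss q alpha z <= c * gauss q alpha x.
    by have := f_ball Ux; move: Wz; rewrite /barrier; lra.
  rewrite ler_pM2l // ler_expR !mulNr lerN2 ler_pM2l // -!sqr_enorm.
  rewrite ler_sqr ?nnegrE ?enorm_ge0 // leNgt => /negP; apply.
  apply: lt_le_trans zq _; apply: le_trans (norm_le_enorm _).
  have := ler_normB (x - q) (z - q); rewrite opprB addrA subrK distrC zx; lra.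
have [_ /Aq[_ xq]] := (Ax, Ax).
have := tha x Ax; rewrite ltNge => /negP; apply.
apply: (threshold_ge Ux c0 alpha0 xq (f_ball Ux)).
have : \forall y \near x, ball z rho y.
  apply: open_nbhs_nbhs; split; first exact: ball_open.
  by rewrite -ball_normE.
rewrite -ball_normE /=.
by apply: filterS => y /ltW zy; apply: xmax; rewrite inE.
Qed.

(** Each point close enough to [z] serves as the center [q] of a barrier. *)
Lemma near_sphere z : U z -> edot (f z) (f z) = r ^+ 2 ->
  \forall y \near z, edot (f y) (f y) = r ^+ 2.
Proof.
move=> Uz fz.
have /nbhs_ballP[e /= e0 he] := near_domain Uz.
(* Halving the radius makes room for a closed ball inside [U]. *)
have BU y : `|z - y| <= e / 2 -> U y.
  move=> ze; apply: he; rewrite -ball_normE /= (le_lt_trans ze) //.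
  by rewrite ltr_pdivrMr // ltr_pMr // ltr1n.
have e20 : 0 < e / 2 by rewrite divr_gt0.
have : \forall y \near z, edot (y - z) (y - z) < (e / 2 / 2) ^+ 2.
  have c := @mx_continuous_at_subr z z.
  have := continuous_edot c c; rewrite /prop_for /continuous_at subrr edot0l.
  by move=> /cvgr_lt; apply; rewrite exprn_gt0 // divr_gt0.
apply: filterS => y zy; apply: (sphere_value_extends e20 BU fz).
rewrite -ltr_sqr ?nnegrE ?enorm_ge0 ?sqr_enorm 1?ltW ?divr_gt0 //.
by rewrite -opprB edotNl edotNr opprK.
Qed.

End StrongMaximum.

(** * Compact submanifolds of the ball *)

Section Charts.
Context {R : realType} {n m : nat} {M : manifold R n} {X : M -> 'rV[R]_m}.

Lemma local_rep_coord (c : chart R n M) x :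
  dom c x -> local_rep X c (Defs.coord c x) = X x.
Proof. by move=> cx; rewrite /local_rep /= Defs.coordK. Qed.

Lemma near_of_chart (c : chart R n M) x (Q : set 'rV[R]_m) : dom c x ->
  (\forall u \near Defs.coord c x, Q (local_rep X c u)) -> \forall y \near x, Q (X y).
Proof.
move=> cx Qx; near=> y.
have cy : dom c y.
  by near: y; apply: open_nbhs_nbhs; split => //; exact: dom_open.
rewrite -(local_rep_coord cy); near: y.
exact: (Defs.coord_continuous cx Qx).
Unshelve. all: by end_near. Qed.

Lemma near_to_chart (c : chart R n M) x (Q : set 'rV[R]_m) : dom c x ->
  (\forall y \near x, Q (X y)) -> \forall u \near Defs.coord c x, Q (local_rep X c u).
Proof.
move=> cx; rewrite -{1}(Defs.coordK cx) => Qx.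
by apply: (param_continuous _ Qx); exists x.
Qed.

End Charts.

(** * From charts to the whole compact submanifold: constancy of [|X|] and minimality *)

Section Global.
Context {R : realType} {n m : nat} {M : manifold R n} {X : M -> 'rV[R]_m}.
Variables (lambda r : R).
Hypothesis X_immersion : immersion X.
Hypothesis X_lambda : lambda_submanifold X lambda.
Hypothesis M_compact : compact [set: M].
Hypothesis lambda_ge0 : 0 <= lambda.
Hypothesis r_gt0 : 0 < r.
Hypothesis r_root : lambda * r + r ^+ 2 = n%:R.
Hypothesis X_ball : forall x, edot (X x) (X x) <= r ^+ 2.

Let r_ge0 : 0 <= r := ltW r_gt0.

Lemma img_coord (c : chart R n M) x : dom c x -> img c (Defs.coord c x).
Proof. by exists x. Qed.

Lemma sphere_near x : edot (X x) (X x) = r ^+ 2 ->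
  \forall y \near x, edot (X y) (X y) = r ^+ 2.
Proof.
move=> Xx; have [c ac cx] := atlas_cover x.
have [fs ff] := X_immersion ac.
apply: (near_of_chart (Q := [set v | edot v v = r ^+ 2]) cx).
apply: (near_sphere (@img_open _ _ _ c) fs ff (X_lambda ac) lambda_ge0 r_ge0 r_root).
- by move=> u _; exact: X_ball.
- exact: img_coord.
- by rewrite local_rep_coord.
Qed.

Lemma continuous_chart c (x : M) : atlas c -> dom c x -> {for x, continuous X}.
Proof.
move=> ac cx Q; rewrite -{1}(local_rep_coord cx) => Qx.
apply: (near_of_chart (Q := Q) cx).
have [fs _] := X_immersion ac.
by have := differentiable_continuous (differentiable_rep fs (img_coord cx)); exact.
Qed.

Lemma immersion_continuous : continuous X.
Proof. by move=> x; have [c ac cx] := atlas_cover x; exact: continuous_chart cx. Qed.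

Lemma continuous_edot_immersion b : continuous (fun x => edot (X x) b).
Proof.
move=> x; apply: continuous_edot; first exact/mx_continuous_at_of/immersion_continuous.
by apply: mx_continuous_at_of; exact: cst_continuous.
Qed.

Lemma continuous_sqr_immersion : continuous (fun x => edot (X x) (X x)).
Proof.
by move=> x; apply: continuous_edot; exact/mx_continuous_at_of/immersion_continuous.
Qed.

(* [|X| = r] is an open condition by the strong maximum principle, so [|X|]
   attains its maximum on the open and closed complement, where the maximum
   must be [r] again. *)
Lemma immersion_sphere x : edot (X x) (X x) = r ^+ 2.
Proof.
apply: contrapT => Wx.
pose W := [set y | edot (X y) (X y) <> r ^+ 2].
have W_closed : closed W.
  rewrite closedE => y; apply: contra_notP => /= /contrapT /sphere_near.
  by apply: filterS => z ?; apply.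
have W_compact : compact W by rewrite -(setTI W); exact: compact_closedI.
have [||y /[!inE] Wy ymax] := @compact_EVT_max _ _
    (fun y => edot (X y) (X y)) W _ W_compact.
- by exists x.
- exact/continuous_subspaceT/continuous_sqr_immersion.
apply: (Wy); have [c ac cy] := atlas_cover y.
have [fs ff] := X_immersion ac.
rewrite -(local_rep_coord cy).
apply: (local_max_sphere (@img_open _ _ _ c) fs ff (X_lambda ac) lambda_ge0 r_ge0 r_root).
- exact: img_coord.
- exact: X_ball.
rewrite (local_rep_coord cy).
apply: (near_to_chart (Q := [set v | edot v v <= edot (X y) (X y)]) cy).
(* By continuity the neighbors of [y] stay in [W], so the maximum over [W] is a local maximum on the
   manifold. *)
have : \forall z \near y, edot (X z) (X z) < r ^+ 2.
  apply: cvgr_lt (continuous_sqr_immersion (x := y)) _ _.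
  by rewrite lt_neqAle X_ball andbT; exact/eqP.
by apply: filterS => z zr; apply: ymax; rewrite inE /W /=; apply/eqP; rewrite lt_eqF.
Qed.

Lemma immersion_minimal : minimal_in_sphere X r.
Proof.
split=> [_ [x _ <-]|c ac u cu]; first by apply/enorm_eq => //; exact: immersion_sphere.
have [fs ff] := X_immersion ac.
have fr : \forall v \near u, edot (local_rep X c v) (local_rep X c v) = r ^+ 2.
  by near=> v; exact: immersion_sphere.
exact: (mean_curvature_sphere_eq0 (@img_open _ _ _ c) fs ff (X_lambda ac)
  lambda_ge0 r_ge0 r_root r_gt0 cu fr).
Unshelve. all: by end_near. Qed.

End Global.

(** * Compact hypersurfaces immersed in a sphere *)

Section Hypersurface.
Context {R : realType}.

(** In codimension one the normal space has dimension [(n + 1) - n = 1], so the nonzero normal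
    vector [a] spans it. *)
Lemma row_free_orthogonal_line n (J : 'M[R]_(n, n + 1)) (a b : 'rV[R]_(n + 1)) :
  row_free J -> a != 0 -> a *m J^T = 0 -> b *m J^T = 0 ->
  exists k, b = k *: a.
Proof.
move=> Jf a0 /sub_kermxP aJ /sub_kermxP bJ; apply/sub_rVP.
apply: submx_trans bJ _; rewrite -(geq_leqif (mxrank_leqif_sup aJ)).
by rewrite mxrank_ker mxrank_tr (eqP Jf) addKn rank_rV a0.
Qed.

(** The entries of [b *m J^T] are the partial derivatives of [<f, b>], which vanish at a local
    maximum. *)
Lemma local_max_orthogonal n m (f : 'rV[R]_n -> 'rV[R]_m) U u b :
  open U -> smooth_on f U -> U u ->
  (\forall y \near u, edot (f y) b <= edot (f u) b) -> b *m ('J f u)^T = 0.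
Proof.
move=> oU fs Uu wmax.
have df : \forall y \near u, differentiable f y.
  by near=> y; apply: (differentiable_rep fs); near: y; exact: near_domain.
have D1 v : \forall y \near u,
    is_derive y v (fun z => edot (f z) b) (edot ('D_v f y) b).
  near=> y; have d : is_derive y v f ('D_v f y).
    by apply/derivableP/diff_derivable; near: y.
  apply: is_derive_eq; first exact: (is_derive_edot d (is_derive_cst b y v)).
  by rewrite edot0r addr0.
have D2 v : derivable ('D_v (fun z => edot (f z) b)) u v.
  apply: (@near_eq_derivable _ _ _ (fun y => edot ('D_v f y) b)).
    by near=> y; rewrite (@derive_val _ _ _ _ _ _ _ (near (D1 v) y _)).
  have d : is_derive u v ('D_v f) ('D_v ('D_v f) u).
    exact/derivableP/diff_derivable/(differentiable_derive_rep fs).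
  by have [] := is_derive_edot d (is_derive_cst b u v).
apply/rowP => i; rewrite [RHS]mxE.
have [|d0 _] := local_max_second_derivative wmax _ (D2 (delta_mx ord0 i)).
  by near=> y; have [] := near (D1 (delta_mx ord0 i)) y _.
rewrite -edot_delta -edot_mulmx -deriveEjacobian; last exact: nbhs_singleton df.
by rewrite -(@derive_val _ _ _ _ _ _ _ (nbhs_singleton (D1 (delta_mx ord0 i)))).
Unshelve. all: by end_near. Qed.

(* A point [b] of the sphere is compared with the point [X x] maximizing
   [edot (X x) b]: both are normal to the hypersurface at [x], so [b = X x] or
   [b = - X x], and the latter forces [X] to be constant. *)
Lemma compact_hypersurface_sphere n (M : manifold R n) (X : M -> 'rV[R]_(n + 1)) r :
  (0 < n)%N -> [set: M] !=set0 -> compact [set: M] -> immersion X -> 0 < r ->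
  (forall x, edot (X x) (X x) = r ^+ 2) -> range X = esphere r.
Proof.
move=> n_gt0 M0 Mc Xi r0 Xr; have r_ge0 := ltW r0.
apply/seteqP; split=> [_ [x _ <-]|b /(enorm_eq _ r_ge0) br].
  exact/enorm_eq.
have cX : {within [set: M], continuous (fun y => edot (X y) b)}.
  exact/continuous_subspaceT/continuous_edot_immersion.
have [x _ xmax] := compact_EVT_max M0 Mc cX.
have {}xmax y : edot (X y) b <= edot (X x) b by apply: xmax; rewrite inE.
have [c ac cx] := atlas_cover x.
have [fs ff] := Xi _ ac.
have cu := img_coord cx.
have fu := local_rep_coord (X := X) cx.
have bJ : b *m ('J (local_rep X c) (Defs.coord c x))^T = 0.
  apply: (local_max_orthogonal (@img_open _ _ _ c) fs cu).
  by near=> v; rewrite fu; exact: xmax.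
(* By Cauchy-Schwarz on the sphere, [<X y, X x>] is at most [r^2], its value at [y = x]; the same
   criterion applies with [X x] in place of [b]. *)
have XJ : X x *m ('J (local_rep X c) (Defs.coord c x))^T = 0.
  apply: (local_max_orthogonal (@img_open _ _ _ c) fs cu).
  near=> v; rewrite fu; apply: le_trans (ler_norm _) _.
  apply: le_trans (edot_le_enorm _ _) _.
  by rewrite Xr expr2 ler_pM ?enorm_ge0 // enorm_le // Xr.
have Xx0 : X x != 0 by rewrite -edot_eq0 Xr gt_eqF // exprn_gt0.
have [k bk] := row_free_orthogonal_line (ff _ cu) Xx0 XJ bJ.
have : k ^+ 2 == 1.
  move: br; rewrite bk edotZl edotZr Xr mulrA -expr2 => k2.
  by apply/eqP/(mulIf (lt0r_neq0 (exprn_gt0 2 r0))); rewrite mul1r.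
rewrite sqrf_eq1 => /orP[]/eqP k1; first by exists x; rewrite // bk k1 scale1r.
(* Here the maximum of [<X, b>] is [- r^2], the least value possible on the sphere, so
   [|X y + b|^2 <= 0]. *)
have Xb y : X y = - b.
  apply/eqP; rewrite -subr_eq0 opprK -edot_eq0 eq_le edot_ge0 andbT.
  rewrite !(edotDl, edotDr) (edotC b) Xr br.
  by have := xmax y; rewrite [in leRHS]bk k1 scaleN1r edotNr Xr; lra.
have fE : local_rep X c = cst (- b) by apply/funext => v; exact: Xb.
(* A constant map has zero Jacobian, which is not row free in dimension [n > 0]. *)
have : delta_mx ord0 (Ordinal n_gt0) = 0 :> 'rV[R]_n.
  apply: (row_free_inj (ff _ cu)); rewrite mul0mx -deriveEjacobian.
    by rewrite fE derive_cst.
  exact: (differentiable_rep fs).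
move=> /rowP /(_ (Ordinal n_gt0)) /eqP.
by rewrite !mxE !eqxx oner_eq0.
Unshelve. all: by end_near. Qed.

End Hypersurface.

(** * Compactness from properness, and the conclusion *)

Lemma compact_closed_eball_preimage (R : realType) n m (M : manifold R n)
    (X : M -> 'rV[R]_m) r :
  proper_map X -> range X `<=` closed_eball r -> compact [set: M].
Proof.
(* A cube containing the ball is compact as a product of segments, and its preimage is all of
   [M]. *)
move=> Xp Xr; pose K : set 'rV[R]_m :=
  [set v | forall i, v ord0 i \in `[- r, r]].
have cK : compact K.
  apply: (@rV_compact _ _ (fun=> `[- r, r]%classic)) => i.
  exact: segment_compact.
rewrite (_ : [set: M] = X @^-1` K); first exact: Xp.
apply/seteqP; split => // x _ i /=; rewrite in_itv /= -ler_norml.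
by apply: le_trans (coord_le_enorm _ _) _; apply: Xr; exists x.
Qed.

Theorem theorem11 (R : realType) (n p : nat) (lambda : R)
    (hn : (1 <= n)%N) (hp : (1 <= p)%N) (hlambda : 0 <= lambda)
    (M : manifold R n) (M_nonempty : [set: M] !=set0)
    (X : M -> 'rV[R]_(n + p))
    (X_immersion : immersion X) (X_proper : proper_map X)
    (X_complete : complete_metric X)
    (X_lambda : lambda_submanifold X lambda)
    (r1 : R) (hr1 : r1 = (- lambda + Num.sqrt (lambda ^+ 2 + 4 * n%:R)) / 2)
    (X_ball : range X `<=` closed_eball r1) :
  [/\ compact [set: M],
      range X `<=` esphere r1,
      minimal_in_sphere X r1
    & p = 1%N -> range X = esphere r1].
Proof.
have n0 : 0 < n%:R :> R by rewrite ltr0n.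
have disc_gt : lambda ^+ 2 < lambda ^+ 2 + 4 * n%:R by rewrite ltrDl mulr_gt0.
(* This strict inequality is what makes [r1] positive. *)
have sqrt_gt : lambda < Num.sqrt (lambda ^+ 2 + 4 * n%:R).
  by rewrite -[ltLHS]ger0_norm // -sqrtr_sqr ltr_sqrt // (le_lt_trans _ disc_gt) ?sqr_ge0.
have sqrtK : Num.sqrt (lambda ^+ 2 + 4 * n%:R) ^+ 2 = lambda ^+ 2 + 4 * n%:R.
  by rewrite sqr_sqrtr // ltW // (le_lt_trans _ disc_gt) // sqr_ge0.
have r0 : 0 < r1 by rewrite hr1 divr_gt0 // addrC subr_gt0.
have r_root : lambda * r1 + r1 ^+ 2 = n%:R.
  rewrite hr1; move: sqrtK; set s := Num.sqrt _; rewrite !expr2 => sK.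
  by lra.
have Mc := compact_closed_eball_preimage X_proper X_ball.
have ball x : edot (X x) (X x) <= r1 ^+ 2.
  by rewrite -enorm_le; [apply: X_ball; exists x|exact: ltW].
have min := immersion_minimal X_immersion X_lambda Mc hlambda r0 r_root ball.
have sph := immersion_sphere X_immersion X_lambda Mc hlambda r0 r_root ball.
split => //; first by case: min.
move=> p1; subst p; exact: compact_hypersurface_sphere.
Qed.
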